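(* Let $X$ be an Archimedean pervasive pre-Riesz space with the Riesz decomposition property and let $I$ be an o-closed directed ideal in $X$. If $I^{dd}$ is directed, then $I$ is a band, i.e. $I=I^{dd}$. In particular, then $$I=\{x\in X : \text{there exists a net } (x_\alpha)_\alpha \text{ in } I \text{ with } x_\alpha\xrightarrow{o} x\}.$$
   Context: An ordered vector space is a real vector space $X$ with the partial order given by a cone $X_+$ ($x\le y$ iff $y-x\in X_+$); it is Archimedean if $nx\le y$ for all $n\in\mathbb{N}$ implies $x\le 0$. A subset $A\subseteq X$ is directed if for all $x,y\in A$ there are $z_1,z_2\in A$ with $z_1\le x,y\le z_2$. $X$ has the Riesz decomposition property (RDP) if for all $x_1,x_2,z\in X_+$ with $z\le x_1+x_2$ there are $z_1,z_2\in X_+$ with $z=z_1+z_2$, $z_1\le x_1$, $z_2\le x_2$. A linear subspace $X_0$ of an ordered vector space $Y$ is order dense in $Y$ if $y=\inf\{z\in X_0: y\le z\}$ for every $y\in Y$. $X$ is a pre-Riesz space if there are a vector lattice $Y$ and a bipositive linear map $i:X\to Y$ (i.e. $x\ge0 \Leftrightarrow i(x)\ge 0$) with $i(X)$ order dense in $Y$; then $(Y,i)$ is called a vector lattice cover of $X$. $X$ is pervasive if for some (equivalently, every) vector lattice cover $(Y,i)$ and every $y\in Y_+$, $y\ne0$, there is $x\in X$ with $0<i(x)\le y$. For $M\subseteq X$ let $M^u$ be the set of all upper bounds of $M$ in $X$. Elements $x,y\in X$ are disjoint, $x\perp y$, if $\{x+y,-x-y\}^u=\{x-y,-x+y\}^u$.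 The disjoint complement of $A\subseteq X$ is $A^{d}:=\{x\in X: x\perp a \text{ for all } a\in A\}$ and $A^{dd}:=(A^d)^d$. A linear subspace $B$ is a band if $B^{dd}=B$. A set $M\subseteq X$ is solid if for all $x\in X$, $y\in M$, $\{x,-x\}^u\supseteq\{y,-y\}^u$ implies $x\in M$; an ideal is a solid linear subspace. A net $(x_\alpha)_\alpha$ in $X$ order converges to $x\in X$, written $x_\alpha\xrightarrow{o}x$, if there is a net $(z_\alpha)_\alpha$ in $X$ (same index set) with $z_\alpha\downarrow 0$ (i.e. decreasing with infimum $0$ in $X$) and $\pm(x-x_\alpha)\le z_\alpha$ for all $\alpha$. A set $M\subseteq X$ is o-closed (order closed) if for every net in $M$ that order converges to some $x\in X$ one has $x\in M$. *)

(* Defs.v *)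
From HB Require Import structures.
From mathcomp Require Import all_boot all_order all_algebra.
From mathcomp Require Import boolp classical_sets reals.

Set Implicit Arguments.
Unset Strict Implicit.
Unset Printing Implicit Defensive.

Import Order.TTheory GRing.Theory Num.Theory.
Local Open Scope classical_set_scope.
Local Open Scope ring_scope.

(* The two axioms say exactly that [set x | 0 <= x] is a cone X_+ and that
   x <= y iff y - x \in X_+; antisymmetry of <= is X_+ `&` - X_+ = [set 0]. *)
HB.mixin Record isOrderedLmodule (R : numDomainType) V
    of Num.POrderedZmodule V & GRing.Lmodule R V := {
  lev_wD2r : forall z x y : V, x <= y -> x + z <= y + z;
  scalev_ge0 : forall (a : R) (x : V), 0 <= a -> 0 <= x -> 0 <= a *: x
}.

#[short(type="orderedLmodType")]
HB.structure Definition OrderedLmodule (R : numDomainType) :=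
  { V of isOrderedLmodule R V & Num.POrderedZmodule V & GRing.Lmodule R V }.

Section OrderedVectorSpaces.
Variables (R : realType) (X : orderedLmodType R).
Implicit Types (A B M I : set X) (x y z : X).

Definition archimedean_ovs : Prop :=
  forall x y, (forall n : nat, (0 < n)%N -> x *+ n <= y) -> x <= 0.

Definition vector_lattice : Prop :=
  forall x y, (exists s, supremums [set x; y] s) /\
              (exists m, infimums [set x; y] m).

Definition directed_set A : Prop :=
  forall x y, A x -> A y ->
    exists z1 z2, [/\ A z1, A z2, z1 <= x /\ z1 <= y & x <= z2 /\ y <= z2].

Definition riesz_decomposition : Prop :=
  forall x1 x2 z, 0 <= x1 -> 0 <= x2 -> 0 <= z -> z <= x1 + x2 ->
    exists z1 z2,
      [/\ 0 <= z1, 0 <= z2, z = z1 + z2, z1 <= x1 & z2 <= x2].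

Definition linear_subspace A : Prop := submod_closed [in A].

Definition order_dense A : Prop :=
  forall y, infimums [set z | A z /\ y <= z] y.

Definition disjoint_elts x y : Prop :=
  ubound [set x + y; - x - y] = ubound [set x - y; - x + y].

Definition dcompl A : set X := [set x | forall a, A a -> disjoint_elts x a].

Definition band B : Prop := linear_subspace B /\ dcompl (dcompl B) = B.

Definition solid M : Prop :=
  forall x y, M y -> ubound [set y; - y] `<=` ubound [set x; - x] -> M x.

Definition ideal I : Prop := linear_subspace I /\ solid I.

Definition directed_preorder (T : Type) (r : T -> T -> Prop) : Prop :=
  [/\ inhabited T, forall a, r a a, forall a b c, r a b -> r b c -> r a c
    & forall a b, exists c, r a c /\ r b c].

Definition o_converges (T : Type) (r : T -> T -> Prop) (u : T -> X) x : Prop :=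
  exists v : T -> X,
    [/\ forall a b, r a b -> v b <= v a, infimums (range v) 0
      & forall a, x - u a <= v a /\ - (x - u a) <= v a].

Definition o_limits M : set X :=
  [set x | exists (T : Type) (r : T -> T -> Prop) (u : T -> X),
    [/\ directed_preorder r, forall a, M (u a) & o_converges r u x]].

Definition o_closed M : Prop := o_limits M `<=` M.

End OrderedVectorSpaces.

Arguments archimedean_ovs {R} X.
Arguments vector_lattice {R} X.
Arguments riesz_decomposition {R} X.

Definition bipositive (R : realType) (X Y : orderedLmodType R) (i : X -> Y) :
    Prop :=
  forall x, 0 <= x <-> 0 <= i x.

Definition vector_lattice_cover (R : realType) (X Y : orderedLmodType R)
    (i : {linear X -> Y}) : Prop :=
  [/\ vector_lattice Y, bipositive i & order_dense (range i)].

Definition pre_riesz (R : realType) (X : orderedLmodType R) : Prop :=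
  exists (Y : orderedLmodType R) (i : {linear X -> Y}),
    vector_lattice_cover i.

Definition pervasive (R : realType) (X : orderedLmodType R) : Prop :=
  exists (Y : orderedLmodType R) (i : {linear X -> Y}),
    vector_lattice_cover i /\
    forall y : Y, 0 <= y -> y != 0 -> exists x : X, 0 < i x /\ i x <= y.

(* Main.v *)
Require Import Defs.
From mathcomp Require Import all_boot all_order all_algebra.
From mathcomp Require Import boolp classical_sets reals.

(** For [0 <= x] in [I^dd], the set [D] of all [a] in [I] with [0 <= a <= x] is
    upward directed, because Riesz decomposition yields interpolation between
    two elements of [D] and [x] together with a common upper bound in [I].
    Moreover [x = sup D]: if [y] is an upper bound of [D] with [~ x <= y], then
    pervasiveness provides [0 < p <= x - inf (x, y)] (the infimum being taken in
    the cover), and, as [p] is not in [I^d], also some [q] in [I] with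
    [0 < q <= p].  By induction every multiple [q *+ n] lies in [D], since
    [q *+ n <= inf (x, y)] implies [q *+ n.+1 <= x]; this contradicts the
    Archimedean property.  So the net [D] order converges to [x], whence
    [x] is in [I]; solidity extends this to all of [I^dd]. *)

Set Implicit Arguments.
Unset Strict Implicit.
Unset Printing Implicit Defensive.

Import Order.TTheory GRing.Theory Num.Theory.
Local Open Scope classical_set_scope.
Local Open Scope ring_scope.

Lemma infimums2 (d : Order.disp_t) (T : porderType d) (x y m : T) :
  infimums [set x; y] m ->
  [/\ m <= x, m <= y & forall z, z <= x -> z <= y -> z <= m]%O.
Proof.
move=> [lb glb]; split; [by apply: lb; left|by apply: lb; right|].
by move=> z zx zy; apply: glb => _ [->|->].
Qed.

(** * Order arithmetic in ordered modules *)

Section OrderedLmoduleTheory.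
Variables (R : numDomainType) (X : orderedLmodType R).
Implicit Types x y z : X.

Lemma subv_ge0 x y : (0 <= y - x) = (x <= y).
Proof.
apply/idP/idP => h; first by move: (lev_wD2r x _ _ h); rewrite add0r subrK.
by move: (lev_wD2r (- x) _ _ h); rewrite subrr.
Qed.

Lemma levD2r z x y : (x + z <= y + z) = (x <= y).
Proof. by rewrite -[LHS]subv_ge0 opprD addrACA subrr addr0 subv_ge0. Qed.

Lemma levD2l z x y : (z + x <= z + y) = (x <= y).
Proof. by rewrite ![z + _]addrC levD2r. Qed.

Lemma levD x y z t : x <= y -> z <= t -> x + z <= y + t.
Proof.
move=> xy zt; apply: (@le_trans _ _ (y + z)); first by rewrite levD2r.
by rewrite levD2l.
Qed.

Lemma addv_ge0 x y : 0 <= x -> 0 <= y -> 0 <= x + y.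
Proof. by move=> x0 y0; rewrite -[0]addr0 levD. Qed.

Lemma levBlDr x y z : (x - z <= y) = (x <= y + z).
Proof. by rewrite -[LHS](levD2r z) subrK. Qed.

Lemma levBrDr x y z : (x <= y - z) = (x + z <= y).
Proof. by rewrite -[LHS](levD2r z) subrK. Qed.

Lemma levN2 x y : (- x <= - y) = (y <= x).
Proof. by rewrite -[LHS]subv_ge0 opprK addrC subv_ge0. Qed.

Lemma oppv_le0 x : (- x <= 0) = (0 <= x).
Proof. by rewrite -{1}oppr0 levN2. Qed.

Lemma oppv_ge0 x : (0 <= - x) = (x <= 0).
Proof. by rewrite -{1}oppr0 levN2. Qed.

Lemma mulvn_ge0 x n : 0 <= x -> 0 <= x *+ n.
Proof.
by move=> x0; elim: n => [|n IH]; rewrite ?mulr0n// mulrS addv_ge0.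
Qed.

Lemma scalev_le0 (a : R) x : 0 <= a -> x <= 0 -> a *: x <= 0.
Proof. by move=> a0; rewrite -!oppv_ge0 -scalerN; exact: scalev_ge0. Qed.

End OrderedLmoduleTheory.

(** * Disjointness, interpolation, order limits and pervasiveness *)

Section OrderedVectorSpaceTheory.
Variables (R : realType) (X : orderedLmodType R).
Implicit Types (a b p q x y z : X) (A I : set X).

Lemma ubound2 x y z : ubound [set x; y] z <-> x <= z /\ y <= z.
Proof.
split=> [h|[hx hy] _ [->|->]//]; by split; apply: h; [left|right].
Qed.

Lemma disjoint_eltsC x y : disjoint_elts x y -> disjoint_elts y x.
Proof.
rewrite /disjoint_elts => h.
by rewrite [y + x]addrC [- y - x]addrC h setUC [- x + y]addrC [x - y]addrC.
Qed.

Lemma disjoint_eltsN x y : disjoint_elts x y -> disjoint_elts (- x) y.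
Proof.
by rewrite /disjoint_elts opprK => h; rewrite setUC -h setUC.
Qed.

(** Both [y - x] and [- y + x] lie below [y], so by disjointness [y + x] does too. *)
Lemma disjoint_elts_le0 x y :
  0 <= x -> x <= y -> disjoint_elts y x -> x <= 0.
Proof.
move=> x0 xy /seteqP[_ h].
have /ubound2[+ _] : ubound [set y + x; - y - x] y.
  apply: h; apply/ubound2; split; first by rewrite levBlDr -{1}[y]addr0 levD2l.
  rewrite addrC; apply: (@le_trans _ _ 0); last exact: le_trans xy.
  by rewrite -oppv_ge0 opprB subv_ge0.
by rewrite -{2}[y]addr0 levD2l.
Qed.

Lemma subset_dcompl2 A : A `<=` dcompl (dcompl A).
Proof. by move=> x Ax a /(_ _ Ax)/disjoint_eltsC. Qed.

Lemma dcomplN A x : dcompl A x -> dcompl A (- x).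
Proof. by move=> Ax a /Ax/disjoint_eltsN. Qed.

(** Decompose [b1 - a1], which is at most [(b1 - a2) + (b2 - a1)] because [a2 <= b2]. The
    interpolant is [a1 + z2 = b1 - z1]; each form gives two of the four bounds. *)
Lemma riesz_interpolation : riesz_decomposition X ->
  forall a1 a2 b1 b2 : X, a1 <= b1 -> a1 <= b2 -> a2 <= b1 -> a2 <= b2 ->
  exists c, [/\ a1 <= c, a2 <= c, c <= b1 & c <= b2].
Proof.
move=> rdp a1 a2 b1 b2 h11 h12 h21 h22.
have [||||z1 [z2 [z10 z20 e hz1 hz2]]] := rdp (b1 - a2) (b2 - a1) (b1 - a1).
- by rewrite subv_ge0.
- by rewrite subv_ge0.
- by rewrite subv_ge0.
- rewrite addrACA -[X in X <= _]addr0 [- a2 - a1]addrC addrACA levD2l.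
  by rewrite subv_ge0.
exists (a1 + z2).
have e' : a1 + z2 = b1 - z1.
  by apply: (addIr z1); rewrite subrK -addrA [z2 + _]addrC -e addrC subrK.
split.
- by rewrite -{1}[a1]addr0 levD2l.
- by rewrite e' levBrDr addrC -levBrDr.
- by rewrite e' levBlDr -{1}[b1]addr0 levD2l.
- by rewrite addrC -levBrDr.
Qed.

Lemma ideal_solid_pos I x y : ideal I -> I y -> 0 <= x -> x <= y -> I x.
Proof.
move=> [_ sI] Iy x0 xy; apply: (sI x y Iy) => u /ubound2[yu _].
apply/ubound2; split; first exact: le_trans xy yu.
by rewrite (@le_trans _ _ 0) ?oppv_le0// (le_trans x0)// (le_trans xy).
Qed.

Lemma o_limits_subset A : A `<=` o_limits A.
Proof.
move=> x Ax; exists unit, (fun _ _ : unit => True), (fun=> x); split => //.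
exists (fun=> 0); split => //; last by move=> _; rewrite subrr oppr0.
split; first by move=> _ [_ _ <-].
by move=> y; apply; exists tt.
Qed.

(** The set [D], indexed by itself, is an increasing net, and [x - a] decreases to [0] along it. *)
Lemma order_converges_sup (D : set X) x :
  (exists a, D a) -> ubound D x -> (forall y, ubound D y -> x <= y) ->
  (forall a b, D a -> D b -> exists c, [/\ D c, a <= c & b <= c]) ->
  o_limits D x.
Proof.
move=> [a0 Da0] Dx xlub dir.
exists {a | D a}, (fun s t => sval s <= sval t), sval.
split; last 1 first.
- exists (fun s => x - sval s); split => [s t st||[a Da] /=].
  + by rewrite levD2l levN2.
  + split; first by move=> _ [[a Da] _ <-] /=; rewrite subv_ge0; exact: Dx.
    (* If [z] is below every [x - a], then [x - z] is an upper bound of [D]. *)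
    move=> z zlb; rewrite -oppv_ge0 -(levD2l x) addr0; apply: xlub => a Da.
    have : z <= x - a by apply: zlb; exists (exist _ a Da).
    by rewrite !levBrDr addrC.
  + split => //; apply: (@le_trans _ _ 0); last by rewrite subv_ge0; exact: Dx.
    by rewrite oppv_le0 subv_ge0; exact: Dx.
- split; [exact: (inhabits (exist _ a0 Da0))|by []| |].
    by move=> a b c; exact: le_trans.
  move=> [a Da] [b Db]; have [c [Dc ac bc]] := dir a b Da Db.
  by exists (exist _ c Dc).
- by case.
Qed.

Lemma bipositive_le (Y : orderedLmodType R) (i : {linear X -> Y}) :
  bipositive i -> forall x y, x <= y <-> i x <= i y.
Proof.
move=> ipos x y; rewrite -subv_ge0 -[i x <= _]subv_ge0 -linearB; exact: ipos.
Qed.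

(** Here [b] replaces the modulus of [a], which need not exist in [X]. By pervasiveness the
    smallness hypothesis forces the infimum of [i p] and [i b] in the cover to be [0]. *)
Lemma pervasive_disjoint p a b : pervasive X -> 0 <= p -> a <= b -> - a <= b ->
  (forall q, 0 <= q -> q <= p -> q <= b -> q <= 0) -> disjoint_elts p a.
Proof.
move=> [Y [i [[lat ipos _] perv]]] p0 ab Nab small.
have ile := bipositive_le ipos.
(* Adding [a <= b] and [- a <= b] gives [0 <= b + b]. *)
have b0 : 0 <= b.
  have : 0 <= (2^-1 : R) *: (b + b).
    by apply: scalev_ge0; rewrite ?invr_ge0 ?ler0n// -(subrr a) levD.
  by rewrite -mulr2n -scaler_nat scalerA mulVf ?scale1r// pnatr_eq0.
have [_ [m /infimums2[mp mb mglb]]] := lat (i p) (i b).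
have m0 : m = 0.
  apply: contrapT => /eqP mn0.
  have [|q [q0 qm]] := perv m _ mn0.
    by apply: mglb; rewrite -(linear0 i); apply/ile.
  suff /ile : q <= 0 by rewrite linear0 => /le_gtF; rewrite q0.
  apply: small; apply/ile; rewrite ?linear0; first exact: ltW.
    exact: le_trans mp.
  exact: le_trans mb.
(* Half of [h] is below both [p] and [b], so its image is below [m = 0]. *)
have small2 h : h <= p + p -> h <= b + b -> h <= 0.
  have half c : h <= c + c -> (2^-1 : R) *: h <= c.
    rewrite -subv_ge0 => hc.
    have : 0 <= (2^-1 : R) *: (c + c - h).
      by apply: scalev_ge0; rewrite ?invr_ge0 ?ler0n.
    rewrite scalerBr -mulr2n -[c *+ 2]scaler_nat scalerA mulVf ?pnatr_eq0//.
    by rewrite scale1r subv_ge0.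
  move=> /half/ile hp /half/ile hb.
  have : (2^-1 : R) *: h <= 0 by apply/ile; rewrite linear0 -m0; exact: mglb.
  move=> /(scalev_le0 (ler0n _ 2)).
  by rewrite scalerA mulfV ?pnatr_eq0// scale1r.
(* [p + c - u] is at most [2 p] and at most [2 c], as [p - c] and [c - p] are
   both below [u]. *)
have sub c u : c <= b -> - c <= b -> p - c <= u -> - p + c <= u ->
    p + c <= u /\ - p - c <= u.
  move=> cb Ncb pu cu; split; last first.
    apply: le_trans pu; rewrite levD2r; apply: (@le_trans _ _ 0) => //.
    by rewrite oppv_le0.
  rewrite -subv_ge0 -oppv_le0 opprB; apply: small2.
    rewrite levBlDr -addrA levD2l.
    by rewrite [p + u]addrC -levBlDr addrC.
  rewrite levBlDr; apply: (@le_trans _ _ (c + c + u)).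
    by rewrite -addrA [p + c]addrC levD2l addrC -levBlDr.
  by rewrite levD2r levD.
(* Replacing [a] by [- a] exchanges the two sets of upper bounds, so [sub] yields both
   inclusions. *)
apply/seteqP; split => u /ubound2[h1 h2]; apply/ubound2.
  by have [] := sub (- a) u; rewrite ?opprK.
by have [] := sub a u.
Qed.

(** Choose [p] with [i p] below [i x - m], where [m] is the infimum of [i x] and [i y]; any [q]
    below [x] and [y] satisfies [i q <= m]. *)
Lemma pervasive_not_le x y : pervasive X -> 0 <= x -> 0 <= y -> ~ x <= y ->
  exists p, [/\ 0 <= p, ~ p <= 0 & forall q, q <= x -> q <= y -> p + q <= x].
Proof.
move=> [Y [i [[lat ipos _] perv]]] x0 y0 nxy.
have ile := bipositive_le ipos.
have [_ [m /infimums2[mx my mglb]]] := lat (i x) (i y).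
have [||p [p0 pm]] := perv (i x - m); first by rewrite subv_ge0.
  by rewrite subr_eq0; apply/eqP => xm; apply: nxy; apply/ile; rewrite xm.
exists p; split; first by apply/ile; rewrite linear0 ltW.
  by move/ile; rewrite linear0 => /le_gtF; rewrite p0.
move=> q qx qy; apply/ile; rewrite linearD -levBrDr (le_trans pm)//.
by rewrite levD2l levN2; apply: mglb; apply/ile.
Qed.

(** * Positive elements of [I^dd] as order limits from [I] *)

Section DirectedIdeal.
Variable I : set X.
Hypotheses (I_ideal : ideal I) (I_directed : directed_set I).

Let I0 : I 0. Proof. by have [[/set_mem]] := I_ideal. Qed.

Let ID x y : I x -> I y -> I (x + y).
Proof.
have [[_ Ilin] _] := I_ideal; move=> Ix Iy.
by have /set_mem := Ilin 1 _ _ (mem_set Ix) (mem_set Iy); rewrite scale1r.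
Qed.

(** Otherwise [p] is in [I^d]: for [a] in [I], directedness gives [b] in [I] above [a] and [- a],
    and positive elements below [b] are in [I] by solidity. So [p] is disjoint from [x], although
    [0 <= p <= x]. *)
Lemma dcompl2_pervasive x p : pervasive X -> dcompl (dcompl I) x ->
  0 <= p -> p <= x -> ~ p <= 0 -> exists q, [/\ I q, 0 <= q, q <= p & ~ q <= 0].
Proof.
move=> perv Bx p0 px pn0; apply: contrapT => noq; apply: pn0.
apply: (@disjoint_elts_le0 p x p0 px); apply: Bx => a Ia.
have INa : I (- a).
  have [[_ Ilin] _] := I_ideal.
  have /set_mem := Ilin (-1) _ _ (mem_set Ia) (mem_set I0).
  by rewrite scaleN1r addr0.
have [_ [b [_ Ib _ [ab Nab]]]] := I_directed Ia INa.
apply: (pervasive_disjoint perv p0 ab Nab) => q q0 qp qb.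
apply: contrapT => nq0; apply: noq; exists q; split => //.
exact: ideal_solid_pos Ib q0 qb.
Qed.

Lemma dcompl2_lub x y : archimedean_ovs X -> pervasive X ->
  dcompl (dcompl I) x -> 0 <= x ->
  ubound [set a | [/\ I a, 0 <= a & a <= x]] y -> x <= y.
Proof.
move=> arch perv Bx x0 Dy; apply: contrapT => nxy.
have y0 : 0 <= y by apply: Dy.
have [p [p0 pn0 hp]] := pervasive_not_le perv x0 y0 nxy.
(* This is [hp] at [0], which is below both [x] and [y]. *)
have px : p <= x by rewrite -[p]addr0; exact: hp.
have [q [Iq q0 qp qn0]] := dcompl2_pervasive perv Bx p0 px pn0.
apply: qn0; apply: (arch q x) => n _.
suff [] : I (q *+ n) /\ q *+ n <= x by [].
elim: n => [|n [Iqn qnx]]; first by rewrite mulr0n.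
rewrite mulrS; split; first exact: ID.
have qny : q *+ n <= y by apply: Dy; split => //; exact: mulvn_ge0.
by apply: le_trans (hp _ qnx qny); rewrite levD2r.
Qed.

Lemma dcompl2_pos_o_limits x : archimedean_ovs X -> pervasive X ->
  riesz_decomposition X -> dcompl (dcompl I) x -> 0 <= x -> o_limits I x.
Proof.
move=> arch perv rdp Bx x0.
pose D := [set a | [/\ I a, 0 <= a & a <= x]].
have [||||T [r [u [dirT Du cv]]]] := @order_converges_sup D x.
- by exists 0; split.
- by move=> a [].
- by move=> y; exact: dcompl2_lub.
- move=> a b [Ia a0 ax] [Ib b0 bx].
  have [_ [w [_ Iw _ [aw bw]]]] := I_directed Ia Ib.
  (* The bound [w] puts [c] in [I] by solidity; the bound [x] keeps it in [D]. *)
  have [c [ac bc cx cw]] := riesz_interpolation rdp ax aw bx bw.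
  have c0 : 0 <= c := le_trans a0 ac.
  by exists c; split => //; split => //; exact: ideal_solid_pos Iw c0 cw.
- by exists T, r, u; split => // t; have [] := Du t.
Qed.

Lemma dcompl2_subset : archimedean_ovs X -> pervasive X ->
  riesz_decomposition X -> o_closed I -> directed_set (dcompl (dcompl I)) ->
  dcompl (dcompl I) `<=` I.
Proof.
move=> arch perv rdp Icl Bdir x Bx.
have pos z : dcompl (dcompl I) z -> 0 <= z -> I z.
  by move=> Bz z0; apply: Icl; exact: dcompl2_pos_o_limits.
(* Directedness reduces to the positive case: [z2] and [- z1] are positive elements of [I^dd], and
   their sum dominates [x] and [- x]. *)
have [z1 [z2 [Bz1 Bz2 [z1x z10] [xz2 z20]]]] := Bdir x 0 Bx (subset_dcompl2 I0).
have Is : I (z2 - z1).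
  by apply: ID; apply: pos => //; [exact: dcomplN|rewrite oppv_ge0].
have [_ sI] := I_ideal; apply: (sI x _ Is) => u /ubound2[su _].
apply/ubound2; split; apply: le_trans su.
  by rewrite -[x]addr0 levD// oppv_ge0.
by rewrite -[- x]add0r levD// levN2.
Qed.

End DirectedIdeal.

End OrderedVectorSpaceTheory.

Theorem theorem15 (R : realType) (X : orderedLmodType R)
    (X_archimedean : archimedean_ovs X)
    (X_preRiesz : pre_riesz X)
    (X_pervasive : pervasive X)
    (X_RDP : riesz_decomposition X)
    (I : set X)
    (I_ideal : ideal I)
    (I_directed : directed_set I)
    (I_o_closed : o_closed I)
    (Idd_directed : directed_set (dcompl (dcompl I))) :
  band I /\ I = o_limits I.
Proof.
split; last by apply/seteqP; split => //; exact: o_limits_subset.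
split; first by have [] := I_ideal.
apply/seteqP; split; last exact: subset_dcompl2.
exact: dcompl2_subset.
Qed.
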